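(* Let $X$ and $P$ be nonempty complete metric spaces and let $F:X\times P\to X$ satisfy the following conditions: (a) For every bounded set $B\subset P$ there exist a metric $d_B$ on $X$, strongly equivalent to the given metric $d$ of $X$, and a constant $0\le C<1$ such that $d_B(F(x,u),F(y,u))\le C\,d_B(x,y)$ for all $x,y\in X$ and all $u\in B$. (b) For every $x\in X$ the map $F_x:P\to X$, $u\mapsto F(x,u)$, is continuous. (c) For every $x\in X$ the map $F_x:P\to X$ is compact. Then the fixed point map $\Phi:P\to X$, which assigns to each $u\in P$ the unique fixed point of $F(\cdot,u)$, i.e. $\Phi(u)=F(\Phi(u),u)$, is well-defined, continuous and compact. If additionally (d) $F$ is locally Lipschitz in $u$ locally uniformly in $x$, then $\Phi:P\to X$ is also locally Lipschitz.
   Context: Two metrics $d,d'$ on $X$ are strongly equivalent if there are constants $M,M'>0$ with $d(x,y)\le M'd'(x,y)$ and $d'(x,y)\le M d(x,y)$ for all $x,y\in X$. A subset $S$ of a metric space is bounded if there is $r\ge 0$ with $d(x,y)\le r$ for all $x,y\in S$ (boundedness is always in the metric sense). A map $H:P\to Z$ between metric spaces is called compact if it maps bounded sets of $P$ to relatively compact sets of $Z$ (sets with compact closure); compact maps are not assumed continuous. A map $H:P\to Z$ is locally Lipschitz if every $u_0\in P$ has a neighborhood $V$ for which there is $L\ge 0$ with $d(H(v),H(w))\le L\,d(v,w)$ for all $v,w\in V$. The map $F:X\times P\to X$ is locally Lipschitz in $u$ locally uniformly in $x$ if for every $x_0\in X$ and $u_0\in P$ there exist neighborhoods $U\subset X$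 of $x_0$ and $V\subset P$ of $u_0$ and a constant $L\ge 0$ such that $d(F(x,v),F(x,w))\le L\,d(v,w)$ for all $x\in U$ and all $v,w\in V$. *)

(* Defs.v *)
From HB Require Import structures.
From mathcomp Require Import all_boot all_order all_algebra.
From mathcomp Require Import all_classical all_reals topology.

Set Implicit Arguments.
Unset Strict Implicit.
Unset Printing Implicit Defensive.

Import Order.TTheory GRing.Theory Num.Theory.

Local Open Scope classical_set_scope.
Local Open Scope ring_scope.

(* Nonemptiness is included: completeType extends pointedType. *)
#[short(type="completeMetricType")]
HB.structure Definition CompleteMetric (R : numDomainType) :=
  {T of Complete T & Metric R T}.

(* A metric given as a bare function, as needed to quantify over several
   metrics on a carrier that already has its own canonical one. *)
Record is_metric (R : realType) (T : Type) (d : T -> T -> R) : Prop := {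
  is_metric_ge0 : forall x y, 0 <= d x y ;
  is_metric_eq0 : forall x y, d x y = 0 <-> x = y ;
  is_metric_sym : forall x y, d x y = d y x ;
  is_metric_triangle : forall x y z, d x z <= d x y + d y z
}.

Definition strongly_equivalent (R : realType) (T : Type)
    (d d' : T -> T -> R) : Prop :=
  exists M M' : R, [/\ 0 < M, 0 < M' &
    forall x y, d x y <= M' * d' x y /\ d' x y <= M * d x y].

Definition metric_bounded (R : realType) (T : metricType R) (S : set T) : Prop :=
  exists2 r : R, 0 <= r & forall x y, S x -> S y -> mdist x y <= r.

(* Continuity is not part of the definition. *)
Definition compact_map (R : realType) (P Z : metricType R) (H : P -> Z) : Prop :=
  forall B : set P, metric_bounded B -> compact (closure (H @` B)).

Definition locally_lipschitz (R : realType) (P Z : metricType R)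
    (H : P -> Z) : Prop :=
  forall u0 : P, exists2 V : set P, nbhs u0 V &
    exists2 L : R, 0 <= L &
      forall v w, V v -> V w -> mdist (H v) (H w) <= L * mdist v w.

Definition locally_lipschitz_locally_uniformly (R : realType)
    (X P Z : metricType R) (F : X * P -> Z) : Prop :=
  forall (x0 : X) (u0 : P), exists (U : set X) (V : set P) (L : R),
    [/\ nbhs x0 U, nbhs u0 V, 0 <= L &
      forall x v w, U x -> V v -> V w ->
        mdist (F (x, v)) (F (x, w)) <= L * mdist v w].

Definition uniform_contraction_on_bounded (R : realType) (X P : metricType R)
    (F : X * P -> X) : Prop :=
  forall B : set P, metric_bounded B ->
    exists (dB : X -> X -> R) (C : R),
      [/\ is_metric dB, strongly_equivalent (@mdist R X) dB, 0 <= C < 1 &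
        forall x y u, B u -> dB (F (x, u)) (F (y, u)) <= C * dB x y].

Definition fixed_point_map (X P : Type) (F : X * P -> X) (Phi : P -> X) : Prop :=
  forall u, unique (fun x => x = F (x, u)) (Phi u).

(* Main.v *)
(* For a map f with d (f x) (f y) <= C * d x y one has
   (1 - C) * d x y <= d (f x) x + d (f y) y.  This gives uniqueness of fixed
   points, shows that the sets {x | d (f x) x <= e} generate a Cauchy filter,
   and, applied to F(., u) at Phi u and Phi v, reduces continuity and the local
   Lipschitz property of Phi to those of F(Phi v, .).
   For compactness: if r-balls around y_1, ..., y_n cover Phi(B), then finite
   e-nets of the sets F(y_i, B) together form a (C * r + e)-net of Phi(B), since
   Phi u = F(Phi u, u).  Hence the infimum of the admissible radii is 0, and
   Phi(B) is totally bounded.  The same infimum argument replaces the Picard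
   iteration: d (f (f x)) (f x) <= C * d (f x) x, so inf_x d (f x) x = 0. *)
Require Import Defs.
From mathcomp Require Import all_boot all_order all_algebra.
From mathcomp Require Import all_classical all_reals topology.
From mathcomp Require Import ring lra.

Set Implicit Arguments.
Unset Strict Implicit.
Unset Printing Implicit Defensive.

Local Open Scope classical_set_scope.
Local Open Scope ring_scope.

Import Order.TTheory GRing.Theory Num.Theory.

(** The metric is explicit because nets are moved between [mdist] and the metrics of condition (a).
    The centres may lie outside [A]. *)
Definition has_finite_net (R : realType) (T : eqType) (d : T -> T -> R)
    (A : set T) (r : R) : Prop :=
  exists s : seq T, forall x, A x -> exists2 y, y \in s & d y x <= r.

(** If r in S lies within e' of inf S, then inf S <= C * r + e', hence (1 - C) * inf S <= (1 + C) *
    e'. The choice e' = (1 - C) * e / 4 then forces r <= e. *)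
Lemma affine_stable_small (R : realType) (S : set R) (C : R) :
  0 <= C < 1 -> S !=set0 -> (forall r, S r -> 0 <= r) ->
  (forall r e, S r -> 0 < e -> S (C * r + e)) ->
  forall e, 0 < e -> exists2 r, S r & r <= e.
Proof.
move=> /andP[C0 C1] S0 Sge0 Sstep e e0.
have lbS : has_lbound S by exists 0 => r /Sge0.
pose e' := (1 - C) * e / 4.
have e'0 : 0 < e' by rewrite /e'; apply: divr_gt0 => //; apply: mulr_gt0 => //; lra.
have [r Sr rlt] := inf_adherent e'0 (conj S0 lbS).
have infle := ge_inf lbS (Sstep _ _ Sr e'0).
exists r => //; apply: ltW; apply: (lt_le_trans rlt).
have Cr : C * r <= C * (inf S + e') by rewrite ler_wpM2l// ltW.
have C1' : 0 < 1 - C by lra.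
have Ce : C * e' <= e' by rewrite ler_piMl ?ltW.
rewrite -(ler_pM2l C1').
have e'E : (1 - C) * e = e' * 4 by rewrite /e'; lra.
lra.
Qed.

Lemma contraction_displacement (R : realType) (T : Type) (d : T -> T -> R)
    (C : R) (f : T -> T) : is_metric d ->
  (forall x y, d (f x) (f y) <= C * d x y) ->
  forall x y, (1 - C) * d x y <= d (f x) x + d (f y) y.
Proof.
move=> md fC x y.
have := is_metric_triangle md x (f x) y.
have := is_metric_triangle md (f x) (f y) y.
rewrite (is_metric_sym md x (f x)); have := fC x y; lra.
Qed.

Lemma contraction_fixed_point (R : realType) (X : completeMetricType R)
    (d : X -> X -> R) (C : R) (f : X -> X) :
  is_metric d -> strongly_equivalent (@mdist R X) d -> 0 <= C < 1 ->
  (forall x y, d (f x) (f y) <= C * d x y) -> exists x, x = f x.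
Proof.
move=> md [M [M' [M0 M'0 Md]]] C01 fC.
have /andP[C0 C1] := C01; have C1' : 0 < 1 - C by lra.
have quasi := contraction_displacement md fC.
pose A e := [set x | d (f x) x <= e].
pose G := filter_from [set e : R | 0 < e] A.
(* The admissible radii are the bounds on some displacement [d (f x) x]; replacing [x] by [f x]
   turns a bound r into C * r. *)
have AP e : 0 < e -> A e !=set0.
  move=> e0.
  have [] := @affine_stable_small R
    [set r | 0 <= r /\ exists x, d (f x) x <= r] C C01 _ _ _ e e0.
  - by exists (d (f point) point); split;
      [exact: is_metric_ge0 | exists point].
  - by move=> r [].
  - move=> r e1 [r0 [x xr]] e10; split.
      by apply: addr_ge0 (ltW _) => //; exact: mulr_ge0.
    exists (f x); rewrite (le_trans (fC _ _))// -[leLHS]addr0.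
    by apply: lerD (ltW e10); exact: ler_wpM2l.
  by move=> r [r0 [x xr]] re; exists x; exact: le_trans re.
have FG : Filter G.
  apply: filter_from_filter; first by exists 1; rewrite /= ltr01.
  move=> i j /= i0 j0; exists (Order.min i j); first by rewrite /= lt_min i0.
  by move=> x /=; rewrite /A /= le_min => /andP[].
have PG : ProperFilter G by apply: filter_from_proper.
have cG : cauchy G.
  apply: cauchy_exP => e e0.
  (* Two points of [A e'] are at [d]-distance at most 2 * e' / (1 - C) = e / (2 * M'), which keeps
     [mdist] below e. *)
  pose e' := (1 - C) * (e / M') / 4.
  have q0 : 0 < e / M' by exact: divr_gt0.
  have e'0 : 0 < e' by apply: divr_gt0 => //; exact: mulr_gt0.
  have [x Ax] := AP _ e'0.
  exists x, e' => // y Ay; rewrite ballEmdist /=.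
  apply: (le_lt_trans (Md x y).1); rewrite mulrC -ltr_pdivlMr//.
  rewrite -(ltr_pM2l C1') (le_lt_trans (quasi x y))//.
  rewrite /A /e' /= in Ax Ay.
  have := mulr_gt0 C1' q0; lra.
set p := lim G; have Gp : G --> p by exact: cauchy_cvg.
exists p; apply/esym/(is_metric_eq0 md)/eqP.
rewrite eq_le is_metric_ge0// andbT; apply/ler_addgt0Pl => e e0; rewrite addr0.
(* For [x] in [A e1] within [e2] of [p], the path from [f p] through [f x] and [x] to [p] has length
   at most e / 4 + e / 2 + e / 4. *)
pose e1 := e / 2; pose e2 := e / (4 * M).
have e10 : 0 < e1 by rewrite divr_gt0.
have e20 : 0 < e2 by apply: divr_gt0 => //; exact: mulr_gt0.
have GA : G (A e1) by exists e1.
have [x [/= xe1]] : A e1 `&` ball p e2 !=set0.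
  apply: (@filter_ex _ G); apply: filterI => //; apply: Gp.
  exact: nbhsx_ballx.
rewrite ballEmdist /= => pe2.
have dpx : d p x <= e / 4.
  apply: (le_trans (Md p x).2).
  have -> : e / 4 = M * e2 by rewrite /e2; field; rewrite gt_eqF.
  by rewrite ler_wpM2l ?ltW.
have dfpx : d (f p) (f x) <= d p x.
  by apply: (le_trans (fC _ _)); rewrite ler_piMl ?is_metric_ge0// ltW.
have := is_metric_triangle md (f p) (f x) p.
have := is_metric_triangle md (f x) x p.
rewrite (is_metric_sym md x p) /A /e1 /= in xe1 *; lra.
Qed.

Lemma compact_closure_finite_net (R : realType) (T : completeMetricType R)
    (A : set T) (e : R) :
  compact (closure A) -> 0 < e -> has_finite_net (@mdist R T) A e.
Proof.
rewrite compact_cover => cA e0.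
have [||D _ AD] := cA T setT (fun y => (ball y e)°).
- by move=> y _; exact: open_interior.
- by move=> x _; exists x => //; apply: nbhsx_ballx.
exists (finmap.enum_fset D) => x /subset_closure /AD [y /= yD] /interior_subset.
by rewrite ballEmdist => /ltW; exists y.
Qed.

(** Pigeonhole for ultrafilters: if [B i] is not in [F], its complement is, and intersecting with it
    drops [i] from the list. *)
Lemma ultra_finite_bigcup (T : Type) (I : eqType) (F : set_system T) (s : seq I)
    (B : I -> set T) :
  UltraFilter F -> F [set x | exists2 i, i \in s & B i x] -> exists i, F (B i).
Proof.
move=> UF; elim: s => [|i s IH] FB.
  suff /filter_ex[] : F set0 by [].
  by apply: filterS FB => x [].
have [?|Fi] := in_ultra_setVsetC (B i) UF; first by exists i.
apply: IH; apply: filterS (filterI Fi FB) => x [/= nB [j]].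
by rewrite inE => /predU1P[->//|js Bj]; exists j.
Qed.

(** An ultrafilter containing [closure A] contains one of finitely many balls of any given radius
    around net points, so it is Cauchy and converges by completeness. *)
Lemma finite_net_compact_closure (R : realType) (X : completeMetricType R)
    (A : set X) :
  (forall e, 0 < e -> has_finite_net (@mdist R X) A e) -> compact (closure A).
Proof.
move=> netA; rewrite compact_ultra => F UF FA.
have cF : cauchy F.
  apply: cauchy_exP => e e0.
  have e20 : 0 < e / 2 by rewrite divr_gt0.
  have e30 : 0 < e / 4 by rewrite divr_gt0.
  have [s sA] := netA _ e20.
  apply: (@ultra_finite_bigcup _ _ F s) => //.
  (* A closure point is within e / 4 of some point of [A], which is within e / 2 of a centre. *)
  apply: filterS FA => x /(_ _ (nbhsx_ballx x _ e30)) [z [Az]].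
  rewrite ballEmdist /= => xz; have [y ys yz] := sA z Az; exists y => //.
  rewrite ballEmdist /=.
  apply: le_lt_trans (metric_triangle _ z _) _.
  rewrite (metric_sym z x); lra.
have Fp : F --> lim F by exact: cauchy_cvg.
exists (lim F); split => //.
by apply: (closed_cvg _ (@closed_closure _ A) _ _ Fp).
Qed.

Lemma has_finite_net_dominated (R : realType) (T : eqType) (d d' : T -> T -> R)
    (M : R) (A : set T) : 0 < M -> (forall x y, d x y <= M * d' x y) ->
  (forall e, 0 < e -> has_finite_net d' A e) ->
  forall e, 0 < e -> has_finite_net d A e.
Proof.
move=> M0 dd' netA e e0; have [s sA] := netA _ (divr_gt0 e0 M0).
exists s => x /sA[y ys yx]; exists y => //.
by rewrite (le_trans (dd' _ _))// mulrC -ler_pdivlMr.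
Qed.

Lemma fixed_points_finite_net (R : realType) (X : eqType) (P : Type)
    (d : X -> X -> R) (C : R) (F : X * P -> X) (B : set P) (Phi : P -> X) :
  X -> is_metric d -> 0 <= C < 1 ->
  (forall x y u, B u -> d (F (x, u)) (F (y, u)) <= C * d x y) ->
  (forall u, Phi u = F (Phi u, u)) ->
  (forall x e, 0 < e -> has_finite_net d [set F (x, u) | u in B] e) ->
  forall e, 0 < e -> has_finite_net d (Phi @` B) e.
Proof.
move=> x0 md C01 FC PhiE netF e e0; have /andP[C0 C1] := C01.
have C1' : 0 < 1 - C by lra.
have [|||r [r0 [s sr]] re] := @affine_stable_small R
  [set r | 0 <= r /\ has_finite_net d (Phi @` B) r] C C01 _ _ _ e e0.
(* Some radius is admissible: [x0] alone is a net, since a 1-net of F(x0, B) bounds the displacement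
   of [x0] under each F(., u) by 1 + m, while [Phi u] has displacement 0. *)
- have [s sF] := netF x0 1 ltr01.
  pose m := \sum_(y <- s) d y x0.
  have m0 : 0 <= m by apply: sumr_ge0 => y _; exact: is_metric_ge0.
  have q0 : 0 <= (1 + m) / (1 - C) by apply: divr_ge0; lra.
  exists ((1 + m) / (1 - C)); split => //.
  exists [:: x0] => _ [u Bu <-]; exists x0; first by rewrite inE.
  have [|y ys yF] := sF (F (x0, u)); first by exists u.
  have ym : d y x0 <= m.
    rewrite /m (perm_big _ (perm_to_rem ys)) big_cons /= lerDl.
    by apply: sumr_ge0 => z _; exact: is_metric_ge0.
  rewrite ler_pdivlMr// mulrC.
  have := contraction_displacement md (fun x y => FC x y u Bu) x0 (Phi u).
  rewrite -PhiE (is_metric_eq0 md (Phi u) _).2//.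
  have := is_metric_triangle md (F (x0, u)) y x0.
  rewrite (is_metric_sym md (F (x0, u)) y); lra.
- by move=> r [].
- move=> r e1 [r0 [s sr]] e10; split.
    by apply: addr_ge0 (ltW _) => //; exact: mulr_ge0.
  have /choice[t tF] := fun y => netF y e1 e10.
  exists (flatten (map t s)) => _ [u Bu <-].
  have [|y ys yr] := sr (Phi u); first by exists u.
  have [|z zt ze] := tF y (F (y, u)); first by exists u.
  exists z; first by apply/flatten_mapP; exists y.
  have := is_metric_triangle md z (F (y, u)) (Phi u).
  rewrite {2}PhiE; have := FC y (Phi u) u Bu.
  have := ler_wpM2l C0 yr; lra.
by exists s => x /sr[y ys yx]; exists y => //; exact: le_trans re.
Qed.

(** The contraction F(., u) fixes [Phi u] and displaces [Phi v] from F(Phi v, v) to F(Phi v, u). The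
    factors M and M' in [K] come from passing to the contracting metric and back. *)
Lemma fixed_point_distance (R : realType) (X P : metricType R)
    (F : X * P -> X) (Phi : P -> X) (B : set P) :
  uniform_contraction_on_bounded F -> (forall u, Phi u = F (Phi u, u)) ->
  metric_bounded B ->
  exists2 K : R, 0 < K & forall u v, B u ->
    mdist (Phi v) (Phi u) <= K * mdist (F (Phi v, v)) (F (Phi v, u)).
Proof.
move=> contrF PhiE /contrF[d [C [md [M [M' [M0 M'0 Md]]] /andP[C0 C1] FC]]].
have C1' : 0 < 1 - C by lra.
exists (M' * (M / (1 - C))); first by rewrite mulr_gt0 ?divr_gt0.
move=> u v Bu; rewrite -mulrA (le_trans (Md _ _).1)// (ler_wpM2l (ltW M'0))//.
rewrite mulrAC ler_pdivlMr// mulrC (le_trans _ (Md _ _).2)//.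
have := contraction_displacement md (fun x y => FC x y u Bu) (Phi v) (Phi u).
by rewrite -!PhiE (is_metric_eq0 md (Phi u) _).2// addr0 (is_metric_sym md (F _)).
Qed.

Lemma metric_bounded_ball (R : realType) (T : metricType R) (x : T) (r : R) :
  metric_bounded (ball x r).
Proof.
have [r0|r0] := leP 0 r; last first.
  exists 0 => // y z; rewrite ballEmdist /= => yr.
  by have := mdist_ge0 x y; lra.
exists (r + r); first exact: addr_ge0.
move=> y z; rewrite ballEmdist /= => yr zr.
have := metric_triangle y x z; rewrite (metric_sym y x); lra.
Qed.

Theorem corollary2p10 (R : realType) (X P : completeMetricType R)
    (F : X * P -> X)
    (contrF : uniform_contraction_on_bounded F)
    (contF : forall x : X, continuous (fun u : P => F (x, u)))
    (compF : forall x : X, compact_map (fun u : P => F (x, u))) :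
  exists Phi : P -> X,
    [/\ fixed_point_map F Phi, continuous Phi, compact_map Phi &
      locally_lipschitz_locally_uniformly F -> locally_lipschitz Phi].
Proof.
have fixE u : exists x, x = F (x, u).
  have [d [C [md eqd C01 FC]]] := contrF _ (metric_bounded_ball u 1).
  apply: (contraction_fixed_point md eqd C01) => x y.
  by apply: FC; exact: ballxx.
have [Phi PhiE] := choice fixE.
have contPhi : continuous Phi.
  move=> v.
  (* One [K] serves the whole unit ball around [v], so continuity of F(Phi v, .) at [v] suffices. *)
  have [K K0 KF] := fixed_point_distance contrF PhiE (metric_bounded_ball v 1).
  apply/cvg_ballP => e e0.
  have Fe : \forall u \near v, ball (F (Phi v, v)) (e / K) (F (Phi v, u)).
    by apply: (cvg_ball (@contF (Phi v) v)); exact: divr_gt0.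
  near=> u.
  rewrite ballEmdist /=.
  have Bu : ball v 1 u by near: u; exact: nbhsx_ballx.
  apply: (le_lt_trans (KF u v Bu)); rewrite mulrC -ltr_pdivlMr//.
  suff : ball (F (Phi v, v)) (e / K) (F (Phi v, u)) by rewrite ballEmdist.
  by near: u; exact: Fe.
exists Phi; split => //.
- move=> u; split => // x xE.
  have [d [C [md _ /andP[C0 C1] FC]]] := contrF _ (metric_bounded_ball u 1).
  have Bu : ball u 1 u by exact: ballxx.
  have := contraction_displacement md (fun x y => FC x y u Bu) (Phi u) x.
  rewrite -PhiE -xE (is_metric_eq0 md (Phi u) (Phi u)).2//.
  rewrite (is_metric_eq0 md x x).2// addr0 pmulr_rle0 ?subr_gt0// => d0.
  by apply/(is_metric_eq0 md)/eqP; rewrite eq_le d0 is_metric_ge0.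
- move=> B bB; have [d [C [md [M [M' [M0 M'0 Md]]] C01 FC]]] := contrF B bB.
  apply: finite_net_compact_closure.
  (* Nets of F(x, B) pass from [mdist] to [d], where the contraction acts; nets of Phi(B) pass
     back. *)
  apply: (has_finite_net_dominated M'0 (fun x y => (Md x y).1)).
  apply: (fixed_points_finite_net point md C01 FC PhiE) => x.
  apply: (has_finite_net_dominated M0 (fun x y => (Md x y).2)) => e.
  by apply: compact_closure_finite_net; exact: compF.
- move=> lipF u0; have [U [V [L [U0 V0 L0 UVL]]]] := lipF (Phi u0) u0.
  have [K K0 KF] := fixed_point_distance contrF PhiE (metric_bounded_ball u0 1).
  (* Continuity of [Phi] makes the preimage of [U] a neighborhood of [u0]; it keeps the first
     argument [Phi v] inside [U], and the ball makes [K] uniform. *)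
  exists (V `&` (Phi @^-1` U `&` ball u0 1)).
    by apply: filterI => //; apply: filterI; [exact: contPhi | exact: nbhsx_ballx].
  exists (K * L); first by rewrite mulr_ge0// ltW.
  move=> v w [Vv [Uv _]] [Vw [_ Bw]]; rewrite -mulrA.
  by rewrite (le_trans (KF w v Bw))// (ler_wpM2l (ltW K0))// UVL.
Unshelve. all: by end_near.
Qed.
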